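(* Let $G=(V,E)$ be a finite graph in which each edge $e$ has a positive integer duration $d_e$, and let $\overline{\delta}=\min_{v\in V}\sum_{e\ni v} d_e$. Then there is a schedule $S:E\to\mathbb{R}$ with coverage at least $\overline{\delta}/8$, i.e. for every vertex $v$ and every time $t$ with $0\le t\le \overline{\delta}/8$ there is an edge $e$ incident to $v$ with $S(e)\le t\le S(e)+d_e$.
   Context: A schedule assigns to each edge $e$ a start time $S(e)$; edge $e$ is then active during $[S(e),S(e)+d_e]$. The schedule has coverage $T$ if every vertex has an active incident edge at every time $t\in[0,T]$.
   Formalization: The graph is additionally assumed to have no isolated vertex: with an isolated vertex the minimum is 0 and the claim fails at t = 0, since no edge is incident to that vertex. *)

(* Defs.v *)
From mathcomp Require Import all_boot all_order all_algebra.
From mathcomp Require Import reals.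

Set Implicit Arguments.
Unset Strict Implicit.
Unset Printing Implicit Defensive.

Import Order.TTheory GRing.Theory Num.Theory.

Local Open Scope ring_scope.

(* A finite graph on V with edges named by E: [ends e] is the set of endpoints
   of e. Parallel edges (e <> f with ends e = ends f) and loops (#|ends e| = 1)
   are allowed; simple graphs are the case of injective [ends] with
   #|ends e| = 2. *)
Definition is_graph (V E : finType) (ends : E -> {set V}) : Prop :=
  forall e : E, (0 < #|ends e| <= 2)%N.

(* An isolated vertex makes the minimum duration degree 0 but is not covered
   even at time 0, so coverage of the closed interval [0, 0] fails there. *)
Definition no_isolated_vertex (V E : finType) (ends : E -> {set V}) : Prop :=
  forall v : V, exists e : E, v \in ends e.

Definition duration_degree (V E : finType) (ends : E -> {set V})
    (d : E -> nat) (v : V) : nat :=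
  (\sum_(e : E | v \in ends e) d e)%N.

(* The neutral value, the total duration, bounds every [duration_degree], so
   this is the true minimum as soon as V is nonempty. *)
Definition min_duration_degree (V E : finType) (ends : E -> {set V})
    (d : E -> nat) : nat :=
  (\big[minn/(\sum_(e : E) d e)]_(v : V) duration_degree ends d v)%N.

Lemma min_duration_degree_le (V E : finType) (ends : E -> {set V})
    (d : E -> nat) (v : V) :
  (min_duration_degree ends d <= duration_degree ends d v)%N.
Proof.
rewrite /min_duration_degree.
elim: (index_enum V) (mem_index_enum v) => // w s IH.
rewrite big_cons inE => /orP[/eqP->|/IH le_s].
  exact: geq_minl.
exact: leq_trans (geq_minr _ _) le_s.
Qed.

Lemma min_duration_degree_attained (V E : finType) (ends : E -> {set V})
    (d : E -> nat) (v0 : V) :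
  exists v : V, min_duration_degree ends d = duration_degree ends d v.
Proof.
have [v _ v_min] := @arg_minnP V v0 xpredT (duration_degree ends d) isT.
exists v; apply/eqP; rewrite eqn_leq min_duration_degree_le /=.
rewrite /min_duration_degree; elim/big_ind: _ => [|m n le_m le_n|w _].
- by rewrite /duration_degree big_mkcond leq_sum // => e _; case: ifP.
- by rewrite leq_min le_m.
- exact: v_min.
Qed.

Definition active (R : realType) (E : finType) (d : E -> nat) (S : E -> R)
    (e : E) (t : R) : Prop :=
  S e <= t <= S e + (d e)%:R.

Definition has_coverage (R : realType) (V E : finType) (ends : E -> {set V})
    (d : E -> nat) (S : E -> R) (T : R) : Prop :=
  forall (v : V) (t : R), 0 <= t <= T ->
    exists2 e : E, v \in ends e & active d S e t.

(* Main.v *)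
Require Import Defs.
From mathcomp Require Import all_boot all_order all_algebra.
From mathcomp Require Import reals.
From mathcomp Require Import perm zify.

Import Order.TTheory GRing.Theory Num.Theory.

Local Open Scope ring_scope.

(** Orient the graph so that at every vertex [v] the edges pointing to [v] have
    total duration at least [(deg v - max v) / 2], where [max v] is the largest
    duration at [v]. To get such an orientation, require that of the two
    longest edges at a vertex exactly one points to it, and split them off:
    they become one path with the two far ends as its ends. A vertex all of
    whose edges last less than [delta / 8] then receives total duration at
    least [delta / 8], and the edges it receives are scheduled one after
    another. An edge lasting at least [delta / 8] starts at [0] and covers both
    of its ends alone. *)

(** Every orbit of [s] has two elements; the one enumerated first gets colour [true]. *)
Lemma involution_coloring (H : finType) (s : H -> H) :
  involutive s -> (forall h, s h != h) ->
  exists c : H -> bool, forall h, c (s h) = ~~ c h.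
Proof.
move=> sK s_neq; exists (fun h => (enum_rank h < enum_rank (s h))%N) => h.
rewrite sK -leqNgt [RHS]leq_eqVlt.
by rewrite (inj_eq (@ord_inj _)) (inj_eq enum_rank_inj) (negPf (s_neq h)).
Qed.

(* [H] is a set of half-edges, [s] swaps the two halves of an edge, [c h] says
   that the edge points to the vertex [p h]. Splitting off two half-edges
   removes them from [A] and re-pairs them with each other under [s]. *)
Lemma balanced_orientation (V H : finType) (p : H -> V) (w : H -> nat)
    (A : {set H}) (B : V -> nat) (s : H -> H) :
  involutive s -> (forall h, s h != h) ->
  (forall h, h \in A -> (w h <= B (p h))%N) ->
  exists2 c : H -> bool, forall h, c (s h) = ~~ c h &
    forall v, (\sum_(h in A | p h == v) w h <=
               2 * (\sum_(h in A | (p h == v) && c h) w h) + B v)%N.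
Proof.
have [n] := ubnP #|A|; elim: n => // n IHn in A B s *.
move=> /ltnSE leAn sK s_neq wB.
have [/existsP[g1 /existsP[g2 /and4P[g1A g2A g12 /eqP pg]]]|no_pair] :=
  boolP [exists g1, exists g2,
    [&& g1 \in A, g2 \in A, g1 != g2 & p g1 == p g2]]; last first.
  (* With at most one half-edge of [A] at each vertex, the term [B v] alone pays for it, so any
     colouring will do. *)
  have [c cs] := involution_coloring H s sK s_neq; exists c => // v.
  have [h /andP[hA /eqP phv]|nov] := pickP [pred h | (h \in A) && (p h == v)].
    rewrite (bigD1 h) ?hA ?phv ?eqxx //= big1 ?addn0; last first.
      move=> g /andP[/andP[gA /eqP pgv] gh]; case/negP: no_pair.
      apply/existsP; exists g; apply/existsP; exists h.
      by rewrite gA hA gh pgv phv eqxx.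
    by rewrite -phv; apply: leq_trans (wB h hA) (leq_addl _ _).
  by rewrite big_pred0.
have [h1 /andP[h1A /eqP ph1] max1] :=
  @arg_maxnP _ g1 [pred h | (h \in A) && (p h == p g1)] w
    ltac:(by rewrite /= g1A eqxx).
have [g [gA gh1 pg1]] : exists g, [/\ g \in A, g != h1 & p g = p g1].
  have [e|ne] := eqVneq g1 h1; last by exists g1.
  by exists g2; rewrite -e eq_sym.
have [h2 /and3P[h2A h21 /eqP ph2] max2] :=
  @arg_maxnP _ g [pred h | [&& h \in A, h != h1 & p h == p g1]] w
    ltac:(by rewrite /= gA gh1 pg1 eqxx).
have w21 : (w h2 <= w h1)%N by apply: max1; rewrite /= h2A ph2 eqxx.
(* Conjugation by [t] yields the pairs [{h1, h2}] and [{s h1, s h2}]. *)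
pose t := tperm h1 (s h2); pose s' h := t (s (t h)).
have tK : involutive t := tpermK _ _.
have s'K : involutive s' by move=> h; rewrite /s' tK sK tK.
have s'_neq h : s' h != h by rewrite /s' -{2}(tK h) (inj_eq perm_inj).
pose A' := A :\ h1 :\ h2.
(* What remains at this vertex is no longer than the second longest half-edge [h2], so the bound
   there drops to [w h2]. *)
pose B' v := if v == p g1 then w h2 else B v.
have inA' h : (h \in A') = [&& h != h2, h != h1 & h \in A] by rewrite !inE.
have ltA' : (#|A'| < n)%N.
  apply: leq_trans leAn; apply: proper_card; apply/properP; split.
    by apply/subsetP => h; rewrite inA' => /and3P[].
  by exists h1; rewrite // inA' eqxx andbF.
have wB' h : h \in A' -> (w h <= B' (p h))%N.
  rewrite inA' /B' => /and3P[hh2 hh1 hA]; case: ifP => [ph|_].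
    by apply: max2; rewrite /= hA hh1.
  exact: wB.
have [c cs cB] := IHn A' B' s' ltA' s'K s'_neq wB'.
have c_far : c (s h1) = ~~ c (s h2).
  by rewrite -cs /s' /t tpermR tpermD // ?(inj_eq (inv_inj sK)) // eq_sym.
(* Undo the splitting: [h1] and [h2] take the colours forced by their old partners. By [c_far] these
   differ. *)
pose c' h := if (h == h1) || (h == h2) then ~~ c (s h) else c h.
have c'A' h : h \in A' -> c' h = c h.
  by rewrite inA' /c' => /and3P[/negPf-> /negPf->].
have c'12 : c' h1 = ~~ c' h2 by rewrite /c' !eqxx orbT /= c_far.
exists c'.
  move=> h; rewrite /c' sK.
  case hK: ((h == h1) || (h == h2)); case shK: ((s h == h1) || (s h == h2)) => //.
  (* Only possible when [h1] and [h2] are the two halves of one edge. *)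
  - rewrite negbK; move: hK shK => /orP[]/eqP-> /orP[]/eqP e.
    + by move: (s_neq h1); rewrite e eqxx.
    + by rewrite c_far -e sK.
    + by rewrite -e sK in c_far *; rewrite c_far negbK.
    + by move: (s_neq h2); rewrite e eqxx.
  - by rewrite negbK.
  - move/negbT/norP: hK => [hh1 hh2]; move/negbT/norP: shK => [sh1 sh2].
    have th : t h = h.
      by rewrite /t tpermD 1?eq_sym //; apply: contra sh2 => /eqP->; rewrite sK.
    have tsh : t (s h) = s h
      by rewrite /t tpermD 1?eq_sym // (inj_eq (inv_inj sK)).
    by have := cs h; rewrite /s' th tsh.
move=> v.
have split (q : pred H) : (\sum_(h in A | (p h == v) && q h) w h =
    (if (p g1 == v) && q h1 then w h1 else 0) +
    ((if (p g1 == v) && q h2 then w h2 else 0) +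
     \sum_(h in A' | (p h == v) && q h) w h))%N.
  rewrite big_mkcondr (bigD1 h1) //= (bigD1 h2) ?h2A //= ph1 ph2.
  rewrite [in RHS]big_mkcondr; congr (_ + (_ + _))%N.
  apply: eq_bigl => h; rewrite inA' andbC [RHS]andbA [in RHS]andbC.
  by case: (h \in A); rewrite ?andbF //= andbC.
have := split xpredT; rewrite !andbT; under eq_bigl do rewrite andbT.
under [X in _ = (_ + (_ + X))%N -> _]eq_bigl do rewrite andbT.
move=> ->; rewrite split.
have -> : (\sum_(h in A' | (p h == v) && c' h) w h =
           \sum_(h in A' | (p h == v) && c h) w h)%N.
  by apply: eq_bigl => h; case hA': (h \in A') => //=; rewrite c'A'.
(* At [p g1] the pair adds [w h1 + w h2] on the left and at least [2 * w h2] on the right. The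
   missing [w h1 - w h2] is covered by the rise of the bound from [w h2] to [B v >= w h1]. *)
have := cB v; rewrite /B' eq_sym c'12; have := wB h1 h1A; rewrite ph1.
by case: eqP => [<-|_] /=; [case: (c' h2) => /=|]; lia.
Qed.

(** Induction peels off the last entry: it covers [t] if it satisfies [P] and starts by then;
    otherwise the prefix does. The hypothesis [has P s] excludes an empty sum with [t = 0]. *)
Lemma consecutive_cover (R : realType) (E : eqType) (P : pred E) (d : E -> nat)
    (s : seq E) (t : R) :
  has P s -> 0 <= t <= (\sum_(e <- s | P e) d e)%N%:R ->
  exists s1 e s2, [/\ s = s1 ++ e :: s2, P e &
    (\sum_(x <- s1 | P x) d x)%N%:R <= t
      <= (\sum_(x <- s1 | P x) d x)%N%:R + (d e)%:R].
Proof.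
elim/last_ind: s => // s a IHs.
have extend : has P s -> 0 <= t <= (\sum_(e <- s | P e) d e)%N%:R ->
  exists s1 e s2, [/\ rcons s a = s1 ++ e :: s2, P e &
    (\sum_(x <- s1 | P x) d x)%N%:R <= t
      <= (\sum_(x <- s1 | P x) d x)%N%:R + (d e)%:R].
  move=> hs /(IHs hs)[s1 [e [s2 [-> Pe te]]]].
  by exists s1, e, (rcons s2 a); rewrite rcons_cat.
rewrite has_rcons -cats1 big_cat big_cons big_nil /= cats1 addn0.
case: ifPn => [Pa _ /andP[t0 tle]|_ /= hs]; last by rewrite addn0; exact: extend.
have [le_t|lt_t] := lerP (\sum_(x <- s | P x) d x)%N%:R t.
  by exists s, a, [::]; rewrite le_t -natrD tle cats1.
apply: extend; last by rewrite t0 ltW.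
apply: contraTT lt_t => /hasPn noP; rewrite -leNgt big_seq_cond big1 //.
by move=> e /andP[/noP/negPf->].
Qed.

Lemma is_graph_ends (V E : finType) (ends : E -> {set V}) :
  is_graph ends ->
  exists p : E * bool -> V, forall e, ends e = [set p (e, true); p (e, false)].
Proof.
move=> gr.
have /fin_all_exists[q qP] e : exists q : V * V, ends e = [set q.1; q.2].
  have /andP[gt0] := gr e.
  rewrite leq_eqVlt => /orP[/cards2P[x [y [_ ->]]]|lt2]; first by exists (x, y).
  have /cards1P[x ->] : #|ends e| == 1%N by rewrite eqn_leq -ltnS lt2.
  by exists (x, x); rewrite setUid.
by exists (fun h => if h.2 then (q h.1).1 else (q h.1).2).
Qed.

Lemma sum_halfedges (E : finType) (Q : pred (E * bool)) (F : E -> nat) :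
  (\sum_(h | Q h) F h.1 =
   \sum_e ((if Q (e, true) then F e else 0) +
           (if Q (e, false) then F e else 0)))%N.
Proof.
under [RHS]eq_bigr do
  rewrite -(big_bool _ (fun b => if Q (_, b) then F _ else 0%N)).
by rewrite big_mkcond pair_bigA; apply: eq_bigr => -[].
Qed.

Theorem theorem8 (R : realType) (V E : finType) (ends : E -> {set V})
    (graph_ends : is_graph ends) (no_isolated : no_isolated_vertex ends)
    (d : E -> nat)
    (d_gt0 : forall e : E, (0 < d e)%N) :
  exists S : E -> R,
    has_coverage ends d S ((min_duration_degree ends d)%:R / 8).
Proof.
have [p pE] := is_graph_ends V E ends graph_ends.
pose w (h : E * bool) := d h.1.
pose B v := (\max_(h | p h == v) w h)%N.
pose s (h : E * bool) := (h.1, ~~ h.2).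
have sK : involutive s by case=> e b; rewrite /s /= negbK.
have s_neq h : s h != h by case: h => e []; rewrite xpair_eqE andbF.
have wB h : h \in setT -> (w h <= B (p h))%N.
  by move=> _; apply: leq_bigmax_cond.
have [c cs cB] := balanced_orientation V _ p w setT B s sK s_neq wB.
set delta := min_duration_degree ends d.
pose head e := p (e, c (e, true)).
have head_in e : head e \in ends e.
  by rewrite pE /head !inE; case: (c _); rewrite eqxx ?orbT.
pose S e : R := if (delta <= 8 * d e)%N then 0 else
  (\sum_(x <- take (index e (enum E)) (enum E) | head x == head e) d x)%N%:R.
exists S => v t /andP[t0 tT].
have [/existsP[e /andP[ve long]]|/existsPn short] :=
  boolP [exists e, (v \in ends e) && (delta <= 8 * d e)%N].
  exists e => //; rewrite /active /S long t0 add0r.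
  apply: le_trans tT _; rewrite ler_pdivrMr // -natrM ler_nat; lia.
have {}short e : v \in ends e -> (8 * d e < delta)%N.
  by move=> ve; have := short e; rewrite ve ltnNge.
have received : (\sum_(e <- enum E | head e == v) d e =
                 \sum_(h in setT | (p h == v) && c h) w h)%N.
  rewrite big_enum_cond big_mkcond /=; under [RHS]eq_bigl do rewrite inE.
  rewrite sum_halfedges; apply: eq_bigr => e _; rewrite /head.
  have /= -> := cs (e, true).
  by case: (c (e, true)); rewrite /= ?andbT ?andbF ?addn0.
(* Only an inequality, since a loop at [v] contributes both of its halves. *)
have deg : (delta <= \sum_(h in setT | p h == v) w h)%N.
  apply: leq_trans (min_duration_degree_le ends d v) _.
  under [leqRHS]eq_bigl do rewrite inE.
  rewrite sum_halfedges /duration_degree big_mkcond leq_sum // => e _.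
  rewrite pE !inE !(eq_sym v).
  by do 2!case: eqP => //= _; rewrite ?addn0 ?leq_addr.
have Bv : (8 * B v <= delta)%N.
  rewrite /B; elim/big_ind: _ => [|m n|[e b] /eqP pv]; [lia|lia|].
  by apply: ltnW; apply: short; rewrite pE -pv !inE; case: (b); rewrite eqxx ?orbT.
(* If [r] is the received total, [delta <= 2 r + delta / 8], so [r] is even at least
   [7 delta / 16]. *)
have enough : (delta <= 8 * \sum_(e <- enum E | head e == v) d e)%N.
  by rewrite received; have := cB v; lia.
(* A short edge at [v] forces [delta > 0], so [v] receives at least one edge. *)
have [e0 ve0] := no_isolated v; have := short e0 ve0 => lt_delta.
have hasv : has (fun e => head e == v) (enum E).
  apply: contraTT enough => /hasPn nov.
  rewrite -ltnNge big_seq_cond big1; first lia.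
  by move=> e /andP[/nov/negPf->].
have t_le : 0 <= t <= (\sum_(e <- enum E | head e == v) d e)%N%:R.
  rewrite t0; apply: le_trans tT _; rewrite ler_pdivrMr // -natrM ler_nat; lia.
have [s1 [e [s2 [Es /eqP hev te]]]] := consecutive_cover R E _ d _ t hasv t_le.
have ve : v \in ends e by rewrite -hev.
exists e => //; rewrite /active /S leqNgt short //= hev.
(* [enum E] has no repetition, so the prefix before [e] that defines [S e] is exactly [s1]. *)
have es1 : e \notin s1.
  by have := enum_uniq E; rewrite Es cat_uniq /= negb_or => /and3P[_ /andP[]].
by rewrite Es index_cat (negPf es1) /= eqxx addn0 take_size_cat.
Qed.
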